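(* There is an absolute constant $C>0$ such that for all positive integers $n,r$ and every input $\mathcal I$ of online Min-Sum Set Cover over a universe of $n$ elements whose requested sets have cardinality at most $r$, $$\mathrm{DLM}(\mathcal I)\le C\, r^2\cdot \mathrm{OPT}(\mathcal I).$$ Here $\mathrm{OPT}(\mathcal I)$ is the minimum total cost of any offline algorithm that starts from the same initial permutation $\pi_0$ and may reorder its list arbitrarily. In other words, DLM is strictly $O(r^2)$-competitive in the dynamic scenario.
   Context: Online Min-Sum Set Cover (MSSC). Let $\mathcal U$ be a universe of $n$ elements. A permutation is a bijection $\pi:\mathcal U\to\{1,\dots,n\}$, where $\pi(z)$ is the list position of $z$. An input $\mathcal I$ consists of an initial permutation $\pi_0$ and a sequence of nonempty sets $R_1,\dots,R_m\subseteq\mathcal U$, each of cardinality at most $r$. In step $t$, an algorithm holding permutation $\pi_{t-1}$ is shown $R_t$ and pays the access cost $\min_{z\in R_t}\pi_{t-1}(z)$. It then picks a new permutation $\pi_t$ and pays the reordering cost $d(\pi_{t-1},\pi_t)$, which is the minimum number of swaps of adjacent elements turning $\pi_{t-1}$ into $\pi_t$. An online algorithm chooses $\pi_t$ without knowing future requests or $m$. $A(\mathcal I)$ denotes the total cost of algorithm $A$ on $\mathcal I$. Algorithm DLM. Every element $z$ has a budget $b(z)$, initially $0$. The operation fetch$(z)$ moves $z$ to position 1 by $\pi(z)-1$ adjacent swaps, so every element that preceded $z$ moves back by one position, and then sets $b(z)\gets 0$. On a request $R$ with $|R|=s$, let $x\in R$ be the element of $R$ with the smallest current position and let $\ell=\pi(x)$.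 DLM pays access cost $\ell$ and executes fetch$(x)$. For every $y\in R\setminus\{x\}$ it sets $b(y)\gets b(y)+\ell/s$. Finally, while some element $z$ has $b(z)\ge \pi(z)$, it executes fetch$(z)$ for such a $z$. *)

(* Defs.v *)
From HB Require Import structures.
From mathcomp Require Import all_boot all_order all_fingroup all_algebra.
From mathcomp Require Import zify.

Set Implicit Arguments.
Unset Strict Implicit.
Unset Printing Implicit Defensive.

Import Order.TTheory GRing.Theory Num.Theory.

Local Open Scope ring_scope.

(* A bijection from U to {0, ..., #|U| - 1}: an injective map between finite
   types of equal cardinality.  [pos] below shifts it to {1, ..., #|U|}. *)
Definition listing (U : finType) : Type :=
  {f : {ffun U -> 'I_#|U|} | injectiveb f}.

HB.instance Definition _ (U : finType) := Finite.on (listing U).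

Section Listings.

Variable U : finType.
Implicit Types (p q : listing U) (z y : U) (R : {set U}).

Definition place p z : 'I_#|U| := val p z.

Definition pos p z : nat := (place p z).+1.

Lemma place_inj p : injective (place p).
Proof. exact/injectiveP/(valP p). Qed.

Lemma listing_ext p q : place p =1 place q -> p = q.
Proof. by move=> e; apply/val_inj/ffunP. Qed.

Lemma relabel_subproof (s : 'I_#|U| -> 'I_#|U|) p (inj_s : injective s) :
  injectiveb [ffun z => s (place p z)].
Proof.
apply/injectiveP => y z; rewrite !ffunE => e.
exact: (place_inj (inj_s _ _ e)).
Qed.

Definition relabel (s : 'I_#|U| -> 'I_#|U|) (inj_s : injective s) p :
  listing U := exist _ [ffun z => s (place p z)] (relabel_subproof p inj_s).

Lemma place_relabel s (inj_s : injective s) p z :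
  place (relabel inj_s p) z = s (place p z).
Proof. by rewrite /place /= ffunE. Qed.

(* q arises from p by exchanging the elements at places i and i + 1. *)
Definition adj_swap p q : bool :=
  [exists i : 'I_#|U|, exists j : 'I_#|U|,
     (j == i.+1 :> nat) && [forall z, place q z == tperm i j (place p z)]].

(* k successive adjacent swaps turn p into q. *)
Definition swaps_to (k : nat) p q : bool :=
  [exists s : k.-tuple (listing U), path adj_swap p s && (last p s == q)].

Lemma swaps_to0 p : swaps_to 0 p p.
Proof. by apply/existsP; exists [tuple]; rewrite /= eqxx. Qed.

Lemma swaps_to1 p q : adj_swap p q -> swaps_to 1 p q.
Proof. by move=> a; apply/existsP; exists [tuple q]; rewrite /= a eqxx. Qed.

Lemma swaps_toD j k p q r :
  swaps_to j p q -> swaps_to k q r -> swaps_to (j + k) p r.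
Proof.
case/existsP=> s /andP[ps /eqP lq] /existsP[t /andP[pt /eqP lr]].
apply/existsP; exists (cat_tuple s t).
by rewrite /= cat_path ps lq pt last_cat lq lr eqxx.
Qed.

Lemma swaps_to_perm (s : 'S_#|U|) p :
  exists k, swaps_to k p (relabel (@perm_inj _ s) p).
Proof.
pose good (t : 'S_#|U|) := forall p', exists k,
  swaps_to k p' (relabel (@perm_inj _ t) p').
suff: good s by apply.
have good1 : good 1%g.
  move=> p'; exists 0%N; suff -> : relabel (@perm_inj _ 1%g) p' = p'.
    exact: swaps_to0.
  by apply: listing_ext => z; rewrite place_relabel perm1.
have goodM t u : good t -> good u -> good (t * u)%g.
  move=> gt gu p'; have [j pj] := gt p'.
  have [k pk] := gu (relabel (@perm_inj _ t) p').
  exists (j + k)%N; apply: swaps_toD pj _.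
  suff -> : relabel (@perm_inj _ (t * u)%g) p' =
            relabel (@perm_inj _ u) (relabel (@perm_inj _ t) p') by [].
  by apply: listing_ext => z; rewrite !place_relabel permM.
have good_adj (i j : 'I_#|U|) : j = i.+1 :> nat -> good (tperm i j).
  move=> ij p'; exists 1%N; apply: swaps_to1; apply/existsP; exists i.
  apply/existsP; exists j; rewrite ij eqxx /=.
  by apply/forallP => z; rewrite place_relabel.
have good_lt m : forall i j : 'I_#|U|, j = (i + m).+1 :> nat ->
    good (tperm i j).
  elim: m => [|m IH] i j ij; first by apply: good_adj; rewrite ij addn0.
  have lt_k : ((i + m).+1 < #|U|)%N.
    by apply: leq_ltn_trans (ltn_ord j); rewrite ij addnS.
  pose k := Ordinal lt_k.
  have kj : good (tperm k j) by apply: good_adj; rewrite ij addnS.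
  have ik : good (tperm i k) by apply: IH.
  have nik : i != k by rewrite -val_eqE /= neq_ltn ltnS leq_addr.
  have nij : i != j by rewrite -val_eqE /= ij neq_ltn ltnS leq_addr.
  have <- : (tperm i k ^ tperm k j)%g = tperm i j.
    by rewrite tpermJ tpermL tpermD // eq_sym.
  by rewrite conjgE tpermV; apply/goodM => //; apply/goodM.
have good_tperm i j : good (tperm i j).
  have [lt|lt|/val_inj ->] := ltngtP i j.
  - by apply: (good_lt (j - i.+1)%N); rewrite -addSn subnKC.
  - by rewrite tpermC; apply: (good_lt (i - j.+1)%N); rewrite -addSn subnKC.
  - by rewrite tperm1.
have [ts -> _] := prod_tpermP s.
by elim: ts => [|t ts IH]; rewrite ?big_nil // big_cons; apply/goodM.
Qed.

Lemma swaps_to_connected p q : exists k, swaps_to k p q.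
Proof.
have bij_p : bijective (place p).
  by apply: inj_card_bij (@place_inj p) _; rewrite card_ord.
case: bij_p => g gK Kg.
have inj_s : injective (fun i => place q (g i)).
  by move=> i j /place_inj /(can_inj Kg).
have [k pk] := swaps_to_perm (perm inj_s) p; exists k.
suff <- : relabel (@perm_inj _ (perm inj_s)) p = q by [].
by apply: listing_ext => z; rewrite place_relabel permE gK.
Qed.

Definition swap_dist p q : nat := ex_minn (swaps_to_connected p q).

(* The neutral value #|U| is an upper bound of [pos p], so for nonempty R this
   is the minimum of [pos p] over R. *)
Definition access_cost p R : nat := \big[minn/#|U|]_(z in R) pos p z.

(* ps lists the permutations chosen after each request of Rs; p is the one held
   before the first request. *)
Fixpoint total_cost p (Rs : seq {set U}) (ps : seq (listing U)) : nat :=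
  match Rs, ps with
  | R :: Rs', q :: ps' =>
      access_cost p R + swap_dist p q + total_cost q Rs' ps'
  | _, _ => 0
  end%N.

Definition opt_cost p (Rs : seq {set U}) : nat :=
  total_cost p Rs
    [arg min_(ps < nseq_tuple (size Rs) p) total_cost p Rs ps].

Lemma front_subproof (k i : 'I_#|U|) :
  ((if i == k then 0 else if i < k then i.+1 else i) < #|U|)%N.
Proof.
case: ifP => _; first exact: leq_ltn_trans (ltn_ord i).
by case: ifP => // ik; apply: leq_ltn_trans (ltn_ord k).
Qed.

Definition front (k i : 'I_#|U|) : 'I_#|U| := Ordinal (front_subproof k i).

Lemma front_inj k : injective (front k).
Proof.
move=> i j /(congr1 val) /=; rewrite -!val_eqE /= => e.
by apply: val_inj => /=; move: e; do 4 (try case: ifP); lia.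
Qed.

Definition move_to_front p z : listing U :=
  relabel (@front_inj (place p z)) p.

Definition state : Type := (listing U * {ffun U -> rat})%type.

Definition fetch (z : U) (st : state) : state :=
  (move_to_front st.1 z, [ffun y => if y == z then 0 else st.2 y]).

Definition ripe (st : state) (z : U) : bool := (pos st.1 z)%:R <= st.2 z.

(* The choice of the fetched element is left open, so all tie-breaking rules
   are covered. *)
Inductive fetch_loop : state -> state -> Prop :=
| fetch_loop_stop st : (forall z, ~~ ripe st z) -> fetch_loop st st
| fetch_loop_next st z st' :
    ripe st z -> fetch_loop (fetch z st) st' -> fetch_loop st st'.

Definition charge R (x : U) (l : nat) (st : state) : state :=
  (st.1, [ffun y => st.2 y +
            (if (y \in R) && (y != x) then l%:R / #|R|%:R else 0)]).

Definition dlm_step R (st st' : state) : Prop :=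
  exists x : U,
    [/\ x \in R,
        forall y, y \in R -> (pos st.1 x <= pos st.1 y)%N
      & fetch_loop (charge R x (pos st.1 x) (fetch x st)) st'].

(* dlm_from st Rs ps: from st, DLM may answer the requests Rs so as to hold the
   successive permutations ps at the ends of the steps. *)
Fixpoint dlm_from (st : state) (Rs : seq {set U}) (ps : seq (listing U)) :
    Prop :=
  match Rs, ps with
  | [::], [::] => True
  | R :: Rs', q :: ps' =>
      exists2 st', dlm_step R st st' & st'.1 = q /\ dlm_from st' Rs' ps'
  | _, _ => False
  end.

Definition dlm_run p (Rs : seq {set U}) (ps : seq (listing U)) : Prop :=
  dlm_from (p, [ffun => 0]) Rs ps.

Lemma fetch_loop_total st : exists st', fetch_loop st st'.
Proof.
have [m] := ubnP #|ripe st|; elim: m st => // m IH st le_m.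
have [/existsP[z rz]|] := boolP [exists z, ripe st z]; last first.
  by move/existsPn => nr; exists st; apply: fetch_loop_stop.
suff /IH[st' l] : (#|ripe (fetch z st)| < m)%N.
  by exists st'; apply: fetch_loop_next l.
rewrite -ltnS; apply: leq_trans le_m; rewrite ltnS.
apply: proper_card; apply/properP; split; last first.
  by exists z => //; rewrite unfold_in /ripe ffunE eqxx lern0.
apply/subsetP => y; rewrite !unfold_in /ripe /= ffunE.
have [->|yz] := eqVneq y z; first by rewrite lern0.
apply: le_trans; rewrite ler_nat /pos ltnS place_relabel /=.
have /negPf -> : place st.1 y != place st.1 z.
  by apply: contra yz => /eqP /place_inj ->.
by case: ifP.
Qed.

Lemma dlm_run_exists p (Rs : seq {set U}) :
  (forall R, R \in Rs -> R != set0) -> exists ps, dlm_run p Rs ps.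
Proof.
rewrite /dlm_run; move: (p, _) => st; elim: Rs st => [|R Rs IH] st nR.
  by exists [::].
have /set0Pn[x0 Rx0] := nR R (mem_head _ _).
pose x := [arg min_(y < x0 in R) pos st.1 y].
have [Rx mx] : x \in R /\ forall y, y \in R -> (pos st.1 x <= pos st.1 y)%N.
  by rewrite /x; case: arg_minnP.
have [st' l] := fetch_loop_total (charge R x (pos st.1 x) (fetch x st)).
have [ps hps] : exists ps, dlm_from st' Rs ps.
  by apply: IH => R' R'Rs; apply: nR; rewrite inE R'Rs orbT.
by exists (st'.1 :: ps); exists st' => //; exists x.
Qed.

Lemma opt_cost_le p (Rs : seq {set U}) (ps : (size Rs).-tuple (listing U)) :
  (opt_cost p Rs <= total_cost p Rs ps)%N.
Proof. by rewrite /opt_cost; case: arg_minnP => // qs _; apply. Qed.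

End Listings.

(* Main.v *)
Require Import Defs.
From mathcomp Require Import all_boot all_order all_fingroup all_algebra.
From mathcomp Require Import zify lra.

Import Order.TTheory GRing.Theory Num.Theory.
Local Open Scope ring_scope.

Set Implicit Arguments.
Unset Strict Implicit.
Unset Printing Implicit Defensive.

(** Fix a = 20 r and give an element with DLM position u, OPT position v and
    budget b the potential 2 b + a max(0, u - a v - b / 2).  An element is
    sensitive to being pushed back only if a v < u; since OPT positions are
    distinct, at most p / a of the first p elements are, so a fetch from
    position p raises the potential of the others by at most p, and a fetch of a
    ripe element is paid by the term 2 b.  On a request answered by DLM at
    position l, consider the element of R that OPT accesses, at OPT position v.
    If its DLM position is below 4 a v, then l < 4 a v and the O(l) cost is
    charged to OPT.  Otherwise its potential decreases with slope about a / 2 in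
    b, so charging l / |R| to it (or fetching it) releases at least 5 l, which
    pays for the step.  A swap of OPT raises the potential by at most
    a ^ 2 = 400 r ^ 2. *)

(** * Swap distance, access cost and list positions *)

Lemma swap_dist_le (U : finType) k (p q : listing U) :
  swaps_to k p q -> (swap_dist p q <= k)%N.
Proof. by rewrite /swap_dist; case: ex_minnP => m _; apply. Qed.

Lemma swaps_to_swap_dist (U : finType) (p q : listing U) :
  swaps_to (swap_dist p q) p q.
Proof. by rewrite /swap_dist; case: ex_minnP. Qed.

Lemma swap_distD (U : finType) (q p p' : listing U) :
  (swap_dist p p' <= swap_dist p q + swap_dist q p')%N.
Proof.
apply/swap_dist_le/(@swaps_toD _ _ _ _ q); exact: swaps_to_swap_dist.
Qed.

Lemma place_move_to_front (U : finType) (p : listing U) z y :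
  place (move_to_front p z) y = front (place p z) (place p y).
Proof. exact: place_relabel. Qed.

(** Induction on the place of [z]: exchanging [z] with its predecessor first does not change the
    result of moving it to the front. Places count from 0, so this is [pos p z - 1] swaps. *)
Lemma swaps_to_move_to_front (U : finType) (p : listing U) z :
  swaps_to (place p z) p (move_to_front p z).
Proof.
move Ek: (nat_of_ord (place p z)) => k; elim: k p Ek => [|k IH] p Ek.
  suff -> : move_to_front p z = p by apply: swaps_to0.
  apply: listing_ext => y; rewrite place_move_to_front.
  by apply: val_inj => /=; rewrite Ek -val_eqE /= Ek; case: eqP.
have lt_k : (k < #|U|)%N by apply: ltn_trans (ltn_ord (place p z)); rewrite Ek.
pose i := Ordinal lt_k; pose j := place p z.
pose p' := relabel (@perm_inj _ (tperm i j)) p.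
have p'z : place p' z = i by rewrite place_relabel tpermR.
have -> : move_to_front p z = move_to_front p' z.
  apply: listing_ext => y; rewrite !place_move_to_front p'z place_relabel.
  rewrite -/j; apply: val_inj => /=; rewrite -!val_eqE /=.
  case: tpermP => [->|->|/eqP ni /eqP nj]; rewrite /= -?/j ?Ek.
  - by do !case: ifP; lia.
  - by do !case: ifP; lia.
  - by move: ni nj; rewrite -!val_eqE /= -/j Ek; do !case: ifP; lia.
rewrite -add1n; apply: swaps_toD (IH p' _); last by rewrite p'z.
apply/swaps_to1/existsP; exists i; apply/existsP; exists j.
by rewrite Ek eqxx; apply/forallP => y; rewrite place_relabel.
Qed.

Lemma access_cost_le (U : finType) (p : listing U) (R : {set U}) x :
  x \in R -> (access_cost p R <= pos p x)%N.
Proof.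
move=> xR; rewrite /access_cost; have := mem_index_enum x.
elim: (index_enum U) => // y s IH; rewrite inE big_cons => /predU1P[<-|/IH le_x].
  by rewrite xR geq_minl.
by case: ifP => // _; apply: leq_trans (geq_minr _ _) le_x.
Qed.

Lemma access_cost_attained (U : finType) (p : listing U) (R : {set U}) :
  R != set0 -> exists2 x, x \in R & (pos p x <= access_cost p R)%N.
Proof.
case/set0Pn => x0 x0R; case: (@arg_minnP _ x0 (mem R) (pos p) x0R) => x xR min_x.
exists x => //; rewrite /access_cost.
apply: (big_ind (fun m => pos p x <= m)%N) => [|m n xm xn|y yR].
(* The neutral value [#|U|] of the minimum is at least every position. *)
- exact: ltn_ord.
- by rewrite leq_min xm.
- exact: min_x.
Qed.

(** The counted elements have distinct places in [q], all below [m %/ a]. This bounds how many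
    elements are sensitive to a fetch. *)
Lemma card_pos_lt (U : finType) (q : listing U) (a m : nat) : (0 < a)%N ->
  (a * #|[set y | a * pos q y < m]| <= m)%N.
Proof.
move=> a0; rewrite mulnC -leq_divRL //.
set S := [set y | _].
have -> : #|S| = size [seq val (place q y) | y <- enum S].
  by rewrite size_map -cardE.
rewrite -[X in (_ <= X)%N](size_iota 0); apply: uniq_leq_size.
  by rewrite map_inj_uniq ?enum_uniq // => y z /val_inj/place_inj.
move=> i /mapP[y]; rewrite mem_enum inE => lt_y ->.
by rewrite mem_iota /= add0n leq_divRL // mulnC ltnW.
Qed.

(** * Potential of a single element *)

Definition elem_pot (a u v : nat) (b : rat) : rat :=
  2 * b + a%:R * Num.max 0 (u%:R - a%:R * v%:R - b / 2).

Definition potential (U : finType) a (q : listing U) (st : state U) : rat :=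
  \sum_z elem_pot a (pos st.1 z) (pos q z) (st.2 z).

Lemma elem_pot_ge a u v b : 2 * b <= elem_pot a u v b.
Proof. by rewrite lerDl mulr_ge0 // le_max lexx. Qed.

Lemma elem_pot_ge_active a u v b :
  2 * b + a%:R * (u%:R - a%:R * v%:R - b / 2) <= elem_pot a u v b.
Proof. by rewrite lerD2l ler_wpM2l // le_max lexx orbT. Qed.

Lemma elem_pot_le a u v b c : 2 * b <= c ->
  2 * b + a%:R * (u%:R - a%:R * v%:R - b / 2) <= c -> elem_pot a u v b <= c.
Proof.
by move=> c1 c2; rewrite /elem_pot; case: (lerP 0) => _; rewrite ?mulr0 ?addr0.
Qed.

Lemma elem_pot_unactive a u v b : u%:R - a%:R * v%:R - b / 2 <= 0 ->
  elem_pot a u v b = 2 * b.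
Proof. by move=> h; rewrite /elem_pot max_l // mulr0 addr0. Qed.

(** The potential has slope at most [a] in [u], and the maximum is still 0 at [u.+1] when
    [u.+1 <= a * v]. *)
Lemma elem_pot_succ a u v b : 0 <= b ->
  elem_pot a u.+1 v b <=
    elem_pot a u v b + (if (a * v < u.+1)%N then a%:R else 0).
Proof.
move=> b0; case: ifP => h.
  apply: elem_pot_le.
    by have := elem_pot_ge a u v b; have := ler0n rat a; lra.
  by have := elem_pot_ge_active a u v b; rewrite -natr1; nra.
rewrite addr0 elem_pot_unactive ?elem_pot_ge //.
have : (u.+1%:R : rat) <= (a * v)%:R by rewrite ler_nat leqNgt h.
by rewrite natrM; lra.
Qed.

Lemma elem_pot_le_opt a u v v' b : (v <= v'.+1)%N ->
  elem_pot a u v' b <= elem_pot a u v b + a%:R ^+ 2.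
Proof.
rewrite -(ler_nat rat) -natr1 => h; have a0 := ler0n rat a.
apply: elem_pot_le; first by have := elem_pot_ge a u v b; nra.
have := elem_pot_ge_active a u v b.
have : a%:R ^+ 2 * v%:R <= a%:R ^+ 2 * (v'%:R + 1) :> rat.
  by apply: ler_wpM2l => //; rewrite exprn_ge0.
by nra.
Qed.

Lemma elem_pot_anti a u v v' b : (v <= v')%N ->
  elem_pot a u v' b <= elem_pot a u v b.
Proof.
rewrite -(ler_nat rat) => h; have a0 := ler0n rat a.
apply: elem_pot_le; first exact: elem_pot_ge.
apply: le_trans (elem_pot_ge_active a u v b); rewrite lerD2l ler_wpM2l //.
by rewrite lerD2r lerD2l lerN2 ler_wpM2l.
Qed.

(** The maximum does not increase with the budget, so only the term [2 * b] can grow. *)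
Lemma elem_pot_charge a u v b e : 0 <= e ->
  elem_pot a u v (b + e) <= elem_pot a u v b + 2 * e.
Proof.
move=> e0; have a0 := ler0n rat a.
apply: elem_pot_le; first by have := elem_pot_ge a u v b; lra.
by have := elem_pot_ge_active a u v b; nra.
Qed.

(* The factor 4 keeps the maximum in its linear regime for budgets up to
   3 u / 2, hence through one charge of at most u / 2 to an unripe element. *)
Lemma elem_pot_charge_active a u v b e : (4 * (a * v) <= u)%N ->
  b + e <= 3 / 2 * u%:R ->
  elem_pot a u v (b + e) <= elem_pot a u v b + (2 - a%:R / 2) * e.
Proof.
rewrite -(ler_nat rat) !natrM => h be; have a0 := ler0n rat a.
have := elem_pot_ge_active a u v b.
rewrite [elem_pot a u v (b + e)]/elem_pot max_r; first by lra.
by lra.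
Qed.

(** * Potential of a state under swaps of OPT, fetches and charges *)

Lemma potential_ge0 (U : finType) a (q : listing U) (st : state U) :
  (forall z, 0 <= st.2 z) -> 0 <= potential a q st.
Proof.
move=> b0; apply: sumr_ge0 => z _; apply: le_trans (elem_pot_ge _ _ _ _).
by rewrite mulr_ge0.
Qed.

Lemma potential_start (U : finType) a (p : listing U) : (0 < a)%N ->
  potential a p (p, [ffun => 0]) = 0.
Proof.
move=> a0; apply: big1 => z _ /=; rewrite ffunE elem_pot_unactive ?mulr0 //.
by rewrite mul0r subr0 -natrM subr_le0 ler_nat leq_pmull.
Qed.

Lemma sumr_card_const (U : finType) (P : pred U) (c : rat) :
  \sum_y (if P y then c else 0) = c * #|[set y | P y]|%:R.
Proof. by rewrite -big_mkcond /= sumr_const -cardsE mulr_natr. Qed.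

(** Only the element moved forward, the one at place [j], can gain potential; its OPT position drops
    by one, which costs at most [a ^ 2]. *)
Lemma potential_adj_swap (U : finType) a (q q' : listing U) (st : state U) :
  adj_swap q q' -> potential a q' st <= potential a q st + a%:R ^+ 2.
Proof.
case/existsP=> i /existsP[j /andP[/eqP ij /forallP qq']].
rewrite /potential.
apply: (@le_trans _ _ (\sum_z (elem_pot a (pos st.1 z) (pos q z) (st.2 z) +
          (if place q z == j then a%:R ^+ 2 else 0)))).
  apply: ler_sum => z _; have := eqP (qq' z); rewrite /pos.
  case: tpermP => [->|->|_ /eqP nj] ->.
  - have /negPf -> : i != j by rewrite -val_eqE /= ij neq_ltn ltnSn.
    by rewrite addr0 elem_pot_anti //; lia.
  - by rewrite eqxx elem_pot_le_opt //; lia.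
  - by rewrite (negPf nj) addr0.
rewrite big_split /= lerD2l sumr_card_const ler_piMr ?exprn_ge0 //.
rewrite (@ler_nat _ _ 1); apply/card_le1_eqP => y z; rewrite !inE.
by move=> /eqP yj /eqP zj; apply: (@place_inj _ q); rewrite yj.
Qed.

Lemma potential_swaps_to (U : finType) a k (q q' : listing U) (st : state U) :
  swaps_to k q q' ->
  potential a q' st <= potential a q st + a%:R ^+ 2 * k%:R.
Proof.
case/existsP=> -[s /= /eqP <-] /andP[]; elim: s q => [|p s IH] q /=.
  by move=> _ /eqP ->; rewrite mulr0 addr0.
case/andP=> qp ps lq'; apply: le_trans (IH p ps lq') _.
by have := potential_adj_swap a st qp; rewrite -natr1; lra.
Qed.

(** The fetched element gives up its whole potential, and each sensitive element before it gains at
    most [a]. *)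
Lemma potential_fetch (U : finType) a (q : listing U) (st : state U) z :
  (0 < a)%N -> (forall y, 0 <= st.2 y) ->
  potential a q (fetch z st) +
    elem_pot a (pos st.1 z) (pos q z) (st.2 z) <=
  potential a q st + (pos st.1 z)%:R.
Proof.
move=> a0 b0; rewrite /potential (bigD1 z) //= [in leRHS](bigD1 z) //=.
rewrite !ffunE eqxx /pos place_move_to_front /= eqxx.
(* At position 1 with budget 0, [z] has potential 0, since [a * pos q z] is at least 1. *)
rewrite elem_pot_unactive; last first.
  by rewrite mul0r subr0 -natrM subr_le0 ler_nat muln_gt0 a0.
suff : \sum_(y | y != z) elem_pot a (pos (move_to_front st.1 z) y) (pos q y)
         ([ffun y => if y == z then 0 else st.2 y] y) <=
       \sum_(y | y != z) elem_pot a (pos st.1 y) (pos q y) (st.2 y) +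
         (pos st.1 z)%:R by rewrite /pos; lra.
pose m := pos st.1 z; rewrite -/m.
apply: (@le_trans _ _
    (\sum_(y | y != z) elem_pot a (pos st.1 y) (pos q y) (st.2 y) +
     \sum_(y | y != z) (if (a * pos q y < m)%N then a%:R else 0))).
  rewrite -big_split; apply: ler_sum => y yz; rewrite ffunE (negPf yz).
  have nz : place st.1 y != place st.1 z.
    by apply: contra yz => /eqP /place_inj ->.
  have ge0 : 0 <= (if (a * pos q y < m)%N then a%:R else 0) :> rat.
    by case: ifP.
  rewrite {1}/pos place_move_to_front /= (negPf nz).
  (* Only elements before [z] move, to positions at most [m], so a sensitive one satisfies
     [a * pos q y < m]. *)
  case: ifP => [lt_yz|_]; last by rewrite lerDl.
  apply: le_trans (elem_pot_succ _ _ _ (b0 y)) _; rewrite lerD2l.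
  case: ifP => // lt1; case: ifP => // /negP[].
  by apply: leq_trans lt1 _; rewrite /m /pos.
rewrite lerD2l.
apply: (@le_trans _ _ (\sum_y (if (a * pos q y < m)%N then a%:R else 0))).
  by rewrite [leRHS](bigD1 z) //= lerDr; case: ifP.
by rewrite sumr_card_const -natrM ler_nat card_pos_lt.
Qed.

Lemma swap_dist_fetch (U : finType) (st : state U) z :
  (swap_dist st.1 (fetch z st).1 < pos st.1 z)%N.
Proof. exact/swap_dist_le/swaps_to_move_to_front. Qed.

Lemma fetch_ge0 (U : finType) (st : state U) z :
  (forall y, 0 <= st.2 y) -> forall y, 0 <= (fetch z st).2 y.
Proof. by move=> b0 y; rewrite ffunE; case: ifP. Qed.

Lemma fetch_loop_potential (U : finType) a (q : listing U) (st st' : state U) :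
  (0 < a)%N -> fetch_loop st st' -> (forall y, 0 <= st.2 y) ->
  [/\ forall y, 0 <= st'.2 y, forall y, ~~ ripe st' y &
    (swap_dist st.1 st'.1)%:R + potential a q st' <= potential a q st].
Proof.
move=> a0; elim=> {st st'} [st nr b0|st z st' rz _ IH b0].
  split=> //; suff -> : swap_dist st.1 st.1 = 0%N by rewrite add0r.
  by apply/eqP; rewrite -leqn0; apply/swap_dist_le/swaps_to0.
have [b0' nr le_pot] := IH (fetch_ge0 z b0); split=> //.
(* Ripeness makes [2 * b] at least twice the position: one half pays the swaps, the other the rise
   of the remaining potentials. *)
have := potential_fetch q z a0 b0.
have := elem_pot_ge a (pos st.1 z) (pos q z) (st.2 z).
have /ltnW := swap_dist_fetch st z; rewrite -(ler_nat rat).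
have := swap_distD (fetch z st).1 st.1 st'.1; rewrite -(ler_nat rat) natrD.
by move: rz le_pot; rewrite /ripe; lra.
Qed.

Lemma potential_charge (U : finType) a (q : listing U) (st : state U)
    (R : {set U}) x l :
  R != set0 ->
  potential a q (charge R x l st) <= potential a q st + 2 * l%:R.
Proof.
move=> R0; have R_gt0 : (0 < #|R|)%N by rewrite card_gt0.
pose e := l%:R / #|R|%:R : rat.
have e0 : 0 <= e by rewrite divr_ge0.
rewrite /potential /charge /=.
have -> : 2 * l%:R = \sum_y (if y \in R then 2 * e else 0).
  rewrite sumr_card_const cardsE -mulrA divfK //.
  by rewrite pnatr_eq0 -lt0n.
rewrite -big_split; apply: ler_sum => y _; rewrite ffunE.
case: (y \in R) => /=; last by rewrite !addr0.
case: (y != x); first exact: elem_pot_charge.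
by rewrite addr0 lerDl mulr_ge0.
Qed.

Lemma potential_charge_active (U : finType) a (q : listing U) (st : state U)
    (R : {set U}) x y l :
  y \in R -> x \in R -> y != x ->
  (l <= pos st.1 y)%N -> st.2 y < (pos st.1 y)%:R ->
  (4 * (a * pos q y) <= pos st.1 y)%N ->
  potential a q (charge R x l st) <=
    potential a q st + 2 * l%:R - a%:R / 2 * (l%:R / #|R|%:R).
Proof.
move=> yR xR yx ly by_lt act.
(* With both [x] and [y] in [R], the charge [e] is at most [l / 2], which keeps the budget of [y]
   within [3 / 2] of its position. *)
have R_gt1 : (1 < #|R|)%N.
  apply: leq_trans (subset_leq_card (_ : [set x; y] \subset R)).
    by rewrite cards2 eq_sym yx.
  by rewrite subUset !sub1set xR.
pose e := l%:R / #|R|%:R : rat.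
have e0 : 0 <= e by rewrite divr_ge0.
have eR : e * #|R|%:R = l%:R by rewrite divfK // pnatr_eq0 -lt0n ltnW.
rewrite /potential /charge /= (bigD1 y) //= [in leRHS](bigD1 y) //=.
rewrite !ffunE yR yx /= -/e.
have : elem_pot a (pos st.1 y) (pos q y) (st.2 y + e) <=
       elem_pot a (pos st.1 y) (pos q y) (st.2 y) + (2 - a%:R / 2) * e.
  apply: elem_pot_charge_active => //.
  by move: R_gt1 ly; rewrite -!(ler_nat rat); nra.
have : \sum_(i | i != y) elem_pot a (pos st.1 i) (pos q i)
          ([ffun y => st.2 y + (if (y \in R) && (y != x) then e else 0)] i) <=
       \sum_(i | i != y) elem_pot a (pos st.1 i) (pos q i) (st.2 i) +
       \sum_(i | i != y) (if i \in R then 2 * e else 0).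
  rewrite -big_split; apply: ler_sum => i _; rewrite ffunE.
  case: (i \in R) => /=; last by rewrite !addr0.
  case: (i != x); first exact: elem_pot_charge.
  by rewrite addr0 lerDl mulr_ge0.
have : \sum_i (if i \in R then 2 * e else 0) = 2 * l%:R.
  by rewrite sumr_card_const cardsE -mulrA eR.
rewrite (bigD1 y) //= yR; lra.
Qed.

(** * Amortized cost of a request and summation over the input *)

Lemma pos_fetch_ge (U : finType) (st : state U) z y : y != z ->
  (pos st.1 y <= pos (fetch z st).1 y)%N.
Proof.
move=> yz; rewrite /pos ltnS place_move_to_front /=.
have /negPf -> : place st.1 y != place st.1 z.
  by apply: contra yz => /eqP /place_inj ->.
by case: ifP.
Qed.

Lemma dlm_step_potential (U : finType) r (q : listing U) (st st' : state U)
    (R : {set U}) :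
  R != set0 -> (#|R| <= r)%N -> (forall y, 0 <= st.2 y) ->
  (forall y, ~~ ripe st y) -> dlm_step R st st' ->
  [/\ forall y, 0 <= st'.2 y, forall y, ~~ ripe st' y &
    (access_cost st.1 R + swap_dist st.1 st'.1)%:R +
        potential (20 * r) q st' <=
      potential (20 * r) q st + 400 * r%:R * (access_cost q R)%:R].
Proof.
move=> R0 Rr b0 nr [x [xR min_x loop]].
have R_gt0 : (0 < #|R|)%N by rewrite card_gt0.
have r0 : (0 < r)%N by apply: leq_trans Rr.
have a0 : (0 < 20 * r)%N by rewrite muln_gt0.
set l := pos st.1 x in loop min_x *; set a := (20 * r)%N in a0 *.
set st1 := fetch x st in loop; set st2 := charge R x l st1 in loop.
have b1 : forall y, 0 <= st1.2 y by apply: fetch_ge0.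
have b2 y : 0 <= st2.2 y.
  by rewrite ffunE addr_ge0 //; case: ifP => // _; rewrite divr_ge0.
have [b' nr' loop_le] := fetch_loop_potential q a0 loop b2.
split=> //.
have [y yR opt_y] := access_cost_attained q R0.
have acc := access_cost_le st.1 xR.
have swap1 : (swap_dist st.1 st1.1 <= l)%N by apply/ltnW/swap_dist_fetch.
have swap2 := swap_distD st1.1 st.1 st'.1.
have fetch1 := potential_fetch q x a0 b0.
have ch := potential_charge a q st1 x l R0.
rewrite -/l -/st1 in fetch1; rewrite -/st2 in ch.
(* Access and first fetch cost at most [2 * l], and the loop pays for itself. The first fetch raises
   the potential by at most [l] and the charges by at most [2 * l], so [5 * l] has to be covered. *)
have cost : (access_cost st.1 R + swap_dist st.1 st'.1)%:R +
    potential a q st' <= 2 * l%:R + potential a q st2.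
  have : (access_cost st.1 R + swap_dist st.1 st'.1 <=
          2 * l + swap_dist st1.1 st'.1)%N by move: acc; rewrite -/l; lia.
  rewrite -(ler_nat rat) (natrD _ (2 * l)) natrM.
  by move: loop_le; rewrite /=; lra.
have aE : a%:R = 20 * r%:R :> rat by rewrite natrM.
have r1 : 1 <= r%:R :> rat by rewrite (ler_nat _ 1).
have l0 := ler0n rat l.
have ex0 : 0 <= elem_pot a l (pos q x) (st.2 x).
  by apply: le_trans (elem_pot_ge _ _ _ _); rewrite mulr_ge0.
have opt0 := ler0n rat (access_cost q R).
have ropt0 : 0 <= r%:R * (access_cost q R)%:R :> rat by rewrite mulr_ge0.
(* In the passive case [l < 80 * r * pos q y], and [5 * l] gives the constant 400. *)
have [act|] := leqP (4 * (a * pos q y)) (pos st.1 y); last first.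
  move=> passive.
  have : l%:R <= 4 * (a%:R * (pos q y)%:R) :> rat.
    by rewrite -!natrM ler_nat (leq_trans (min_x _ yR)) // ltnW.
  have : r%:R * (pos q y)%:R <= r%:R * (access_cost q R)%:R :> rat.
    by rewrite ler_wpM2l // ler_nat.
  by rewrite aE; lra.
(* If [y = x], the fetch releases at least [a * l / 4 = 5 * r * l], because [x] was unripe and
   [a * pos q x <= l / 4]. *)
have [yx|yx] := eqVneq y x.
  have := nr x; rewrite /ripe -ltNge -/l => bl.
  have := elem_pot_ge_active a l (pos q x) (st.2 x).
  have act_x : 4 * (a%:R * (pos q x)%:R) <= l%:R :> rat.
    by rewrite -!natrM ler_nat /l -yx.
  have : a%:R * (l%:R / 4) <=
         a%:R * (l%:R - a%:R * (pos q x)%:R - st.2 x / 2) :> rat.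
    by rewrite ler_wpM2l //; have := b0 x; lra.
  by rewrite aE; have := b0 x; nra.
(* Fetching [x] never moves [y] forward, so [y] stays active and unripe; its charge then releases
   [10 * r * l / #|R|], at least [10 * l]. *)
have pos1 := pos_fetch_ge st yx.
have : potential a q st2 <=
       potential a q st1 + 2 * l%:R - a%:R / 2 * (l%:R / #|R|%:R).
  apply: (potential_charge_active (y := y)) => //.
  - exact: leq_trans (min_x _ yR) pos1.
  - rewrite ffunE (negPf yx); have := nr y; rewrite /ripe -ltNge => lt_y.
    by apply: lt_le_trans lt_y _; rewrite ler_nat.
  - exact: leq_trans act pos1.
have : l%:R <= r%:R * (l%:R / #|R|%:R) :> rat.
  rewrite mulrCA ler_peMr // ler_pdivlMr ?ltr0n // mul1r ler_nat //.
rewrite aE; lra.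
Qed.

(** The amortized bounds telescope: DLM serves the request while OPT still holds [q], then OPT moves
    to [q']. Arbitrary starting lists and budgets let the induction go through. *)
Lemma dlm_from_competitive (U : finType) r (q : listing U) (st : state U)
    (Rs : seq {set U}) (ps qs : seq (listing U)) :
  (forall R : {set U}, R \in Rs -> R != set0 /\ (#|R| <= r)%N) ->
  (forall y, 0 <= st.2 y) -> (forall y, ~~ ripe st y) ->
  size qs = size Rs -> dlm_from st Rs ps ->
  (total_cost st.1 Rs ps)%:R <=
    potential (20 * r) q st + 400 * r%:R ^+ 2 * (total_cost q Rs qs)%:R.
Proof.
elim: Rs q st ps qs => [|R Rs IH] q st [|p ps] [|q' qs] //= wf b0 nr.
  by move=> _ _; rewrite mulr0 addr0 potential_ge0.
move=> [size_qs] [st' step [<- run]].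
have [R0 Rr] := wf R (mem_head _ _).
have [b' nr' step_le] := dlm_step_potential q R0 Rr b0 nr step.
have wf' R' : R' \in Rs -> R' != set0 /\ (#|R'| <= r)%N.
  by move=> R'Rs; apply: wf; rewrite inE R'Rs orbT.
have := IH q' st' ps qs wf' b' nr' size_qs run.
have := potential_swaps_to (20 * r) st' (swaps_to_swap_dist q q').
rewrite natrM.
have r1 : 1 <= r%:R :> rat.
  by rewrite (ler_nat _ 1); apply: leq_trans Rr; rewrite card_gt0.
(* OPT's access costs carry only a factor [r]; the factor [r ^ 2] comes from its swaps. *)
have : r%:R * (access_cost q R)%:R <= r%:R ^+ 2 * (access_cost q R)%:R :> rat.
  by rewrite ler_wpM2r // expr2 ler_peMr.
by move: step_le; rewrite !natrD; lra.
Qed.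

Theorem theorem13 :
  exists C : rat, 0 < C /\
    forall (n r : nat) (U : finType) (p0 : listing U) (Rs : seq {set U})
           (ps : seq (listing U)),
      (0 < n)%N -> (0 < r)%N -> #|U| = n ->
      (forall R : {set U}, R \in Rs -> R != set0 /\ (#|R| <= r)%N) ->
      dlm_run p0 Rs ps ->
      (total_cost p0 Rs ps)%:R <= C * r%:R ^+ 2 * (opt_cost p0 Rs)%:R.
Proof.
exists 400; split=> [|n r U p0 Rs ps _ r0 _ wf run]; first by rewrite ltr0n.
have a0 : (0 < 20 * r)%N by rewrite muln_gt0.
(* Both lists start equal with zero budgets, so the initial potential vanishes and no additive term
   remains. *)
rewrite -[leRHS]add0r -(potential_start p0 a0) /opt_cost.
apply: (@dlm_from_competitive _ r p0 (p0, [ffun => 0])) wf _ _ _ run.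
- by move=> y; rewrite ffunE.
- by move=> y; rewrite /ripe ffunE lern0.
- exact: size_tuple.
Qed.
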